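(* For $n\ge 3$, $a_n(13;2\to 2)=d_n+d_{n-1}+\sum_{k=1}^{n-1}(d_{n-k}+d_{n-k-1})(k-1)!$, where $d_m$ is the $m$-th derangement number.
   Context: Standard cycle form of $\sigma\in S_n$: product of disjoint cycles (fixed points included), each cycle starting with its largest element, cycles listed in increasing order of largest elements. The fundamental bijection $\theta:S_n\to S_n$ erases the parentheses of the standard cycle form to give a one-line permutation. For $\pi\in S_n$, $\hat\pi=\theta^{-1}(\pi)$. An arrow pattern $(\nu;H)$ of size $k$: a string $\nu=a_1\dots a_m$ of positive integers and a set $H$ of arrows $b\to c$, with all integers appearing forming $[k]$. $\pi\in S_n$ contains $(\nu;H)$ if there is $X=\{x_1<\dots<x_k\}\subseteq[n]$ with positions $t_1<\dots<t_m$ such that $\pi_{t_1}\cdots\pi_{t_m}=x_{a_1}\cdots x_{a_m}$ and $\hat\pi(x_b)=x_c$ for every arrow $b\to c\in H$; otherwise it avoids it. $a_n(\nu;H)$ = number of $\pi\in S_n$ avoiding $(\nu;H)$. $d_m$ = number of fixed-point-free permutations of $[m]$, with $d_0=1$. *)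

(* Defs.v *)
From mathcomp Require Import all_boot fingroup perm.

Set Implicit Arguments.
Unset Strict Implicit.
Unset Printing Implicit Defensive.

(* The set [n] is represented by 'I_n = {0, ..., n-1} (all values are shifted
   down by one), and a permutation pi : 'S_n has one-line notation
   pi 0, pi 1, ..., pi (n-1). *)

Section FundamentalBijection.
Variable n : nat.
Implicit Types s pi : 'S_n.

Definition is_cycle_max s (m : 'I_n) : bool :=
  all (fun j : 'I_n => j <= m) (orbit s m).

(* [enum 'I_n] is increasing, and [orbit s m] is [:: m; s m; s (s m); ...]. *)
Definition standard_cycles s : seq (seq 'I_n) :=
  [seq orbit s m | m <- enum 'I_n & is_cycle_max s m].

Definition theta_word s : seq 'I_n := flatten (standard_cycles s).

Definition wf_cycle (c : seq 'I_n) : bool :=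
  if c is m :: r then all (fun j : 'I_n => j < m) r else false.

Lemma orbit_cons s m : exists r, orbit s m = m :: r.
Proof. by rewrite /orbit -orderSpred /=; eexists. Qed.

Lemma standard_cycles_wf s : all wf_cycle (standard_cycles s).
Proof.
apply/allP=> c /mapP[m]; rewrite mem_filter => /andP[mx _] ->.
have [r er] := orbit_cons s m; move: mx (orbit_uniq s m).
rewrite /is_cycle_max er /= => /andP[_ /allP mx] /andP[mr _].
apply/allP=> j jr; rewrite ltn_neqAle mx // andbT.
by apply: contraNneq mr => /val_inj <-.
Qed.

Definition head_lt (c1 c2 : seq 'I_n) : bool :=
  match c1, c2 with m1 :: _, m2 :: _ => m1 < m2 | _, _ => false end.

Lemma standard_cycles_sorted s : sorted head_lt (standard_cycles s).
Proof.
rewrite /standard_cycles sorted_map.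
have/(sub_sorted (e' := relpre (orbit s) head_lt)) : 
  subrel (fun i j : 'I_n => i < j) (relpre (orbit s) head_lt).
  move=> i j ij /=; have [r ->] := orbit_cons s i.
  by have [r' ->] := orbit_cons s j.
apply; apply: sorted_filter; first by move=> x y z; apply: ltn_trans.
have := iota_ltn_sorted 0 n; rewrite -val_enum_ord sorted_map.
by apply: sub_sorted.
Qed.

Lemma flatten_cycles_inj (L L' : seq (seq 'I_n)) :
  all wf_cycle L -> all wf_cycle L' ->
  sorted head_lt L -> sorted head_lt L' -> flatten L = flatten L' -> L = L'.
Proof.
have split_head (m : 'I_n) r (K : seq (seq 'I_n)) :
  all (fun j : 'I_n => j < m) r -> path head_lt (m :: r) K ->
  find (fun j : 'I_n => m <= j) (r ++ flatten K) = size r.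
  move=> rm pK; rewrite find_cat ifF; last first.
    apply/negbTE; rewrite -all_predC; apply: sub_all rm => j /=.
    by rewrite -ltnNge.
  case: K pK => [|[|m1 r1] K] /=; rewrite ?addn0 //.
  by case/andP=> lt1 _; rewrite ltnW //= addn0.
elim: L L' => [|[|m r] L IH] [|[|m' r'] L'] //=.
move=> /andP[rm wL] /andP[rm' wL'] pL pL' [em e]; subst m'.
have sz : size r = size r'.
  by rewrite -(split_head m r L) // e split_head.
have [er eL] : r = r' /\ flatten L = flatten L'.
  by move/eqP: e; rewrite eqseq_cat // => /andP[/eqP-> /eqP->].
by rewrite er (IH L') // (path_sorted pL, path_sorted pL').
Qed.

Lemma mem_theta_word s i : i \in theta_word s.
Proof.
pose m := [arg max_(j > i in orbit s i) val j].
have [mi mmax] : m \in orbit s i /\ forall j, j \in orbit s i -> j <= m.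
  by rewrite /m; case: arg_maxnP => [|m' ? ?]; rewrite ?in_orbit.
have fc j : (j \in orbit s m) = (j \in orbit s i).
  rewrite -!fconnect_orbit; apply: (same_connect (fconnect_sym perm_inj)).
  by rewrite (fconnect_sym perm_inj) fconnect_orbit.
apply/flattenP; exists (orbit s m); last by rewrite fc in_orbit.
apply: map_f; rewrite mem_filter mem_enum andbT.
by apply/allP=> j; rewrite fc; apply: mmax.
Qed.

Lemma uniq_theta_word s : uniq (theta_word s).
Proof.
rewrite /theta_word /standard_cycles.
have uf : uniq [seq m <- enum 'I_n | is_cycle_max s m].
  by rewrite filter_uniq ?enum_uniq.
have: all (is_cycle_max s) [seq m <- enum 'I_n | is_cycle_max s m].
  exact: filter_all.
elim: [seq m <- _ | _] uf => //= m L IH /andP[mL uL] /andP[mm mxL].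
rewrite cat_uniq orbit_uniq IH // andbT /=; apply/hasPn => j.
case/flattenP=> _ /mapP[m' m'L ->]; rewrite -!fconnect_orbit => m'j.
apply: contra mL => mj.
have mm' : fconnect s m m'.
  by apply: connect_trans mj _; rewrite (fconnect_sym perm_inj).
have e : m = m'.
  apply/val_inj/eqP; rewrite eqn_leq.
  rewrite (allP mm) -?fconnect_orbit // (allP (allP mxL _ m'L)) //.
  by rewrite -fconnect_orbit (fconnect_sym perm_inj).
by rewrite e.
Qed.

Lemma size_theta_word s : size (theta_word s) = n.
Proof.
rewrite -(card_uniqP (uniq_theta_word s)) -[RHS]card_ord.
by apply: eq_card => i; rewrite mem_theta_word.
Qed.

(* The default value [i] of [nth] is never used, by [size_theta_word]. *)
Definition theta_fun s (i : 'I_n) : 'I_n := nth i (theta_word s) i.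

Lemma theta_fun_inj s : injective (theta_fun s).
Proof.
move=> i j; rewrite /theta_fun (set_nth_default j) ?size_theta_word //.
move/eqP; rewrite nth_uniq ?size_theta_word ?uniq_theta_word //.
by move/eqP/val_inj.
Qed.

Definition theta s : 'S_n := perm (@theta_fun_inj s).

Lemma theta_wordE s : theta_word s = [seq theta s i | i <- enum 'I_n].
Proof.
case: (posnP n) => [n0|n_gt0].
  apply: etrans (esym _); apply: size0nil.
    by rewrite size_theta_word.
  by rewrite size_map size_enum_ord.
pose i0 := Ordinal n_gt0.
apply: (@eq_from_nth _ i0) => [|i].
  by rewrite size_theta_word size_map size_enum_ord.
rewrite size_theta_word => lti; rewrite (nth_map i0) ?size_enum_ord //.
rewrite permE /theta_fun nth_enum_ord //.
by apply: set_nth_default; rewrite size_theta_word.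
Qed.

Lemma theta_inj : injective theta.
Proof.
move=> s s' e; have ew : theta_word s = theta_word s' by rewrite !theta_wordE e.
have ec : standard_cycles s = standard_cycles s'.
  by apply: flatten_cycles_inj ew; rewrite ?standard_cycles_wf
    ?standard_cycles_sorted.
apply/permP=> i; have /flattenP[c cs ic] := mem_theta_word s i.
have nextE t : c \in standard_cycles t -> t i = next c i.
  case/mapP=> m _ ec'; apply/eqP.
  have := next_cycle (cycle_orbit (@perm_inj _ t) m).
  by rewrite -ec' => /(_ i ic).
by rewrite (nextE s) // (nextE s') // -ec.
Qed.

Definition hat pi : 'S_n := invF theta_inj pi.

Lemma theta_hat pi : theta (hat pi) = pi.
Proof. exact: f_invF. Qed.

End FundamentalBijection.

(* An arrow pattern (nu; H) of size k, with m = |nu|. The labels 1, ..., k are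
   represented by 'I_k, i.e., shifted down by one; an arrow b -> c is the
   pair (b, c). *)
Record arrow_pattern (k m : nat) := ArrowPattern {
  ap_word : m.-tuple 'I_k;
  ap_arrows : {set 'I_k * 'I_k};
  ap_onto : [forall i : 'I_k, (i \in ap_word) ||
               [exists a in ap_arrows, (i == a.1) || (i == a.2)]]
}.

Definition increasing (k n : nat) (f : {ffun 'I_k -> 'I_n}) : bool :=
  [forall i : 'I_k, forall j : 'I_k, (i < j) ==> (f i < f j)].

(* [x] lists the elements of X in increasing order, [t] the positions. *)
Definition contains (n k m : nat) (p : arrow_pattern k m) (pi : 'S_n) : bool :=
  [exists x : {ffun 'I_k -> 'I_n}, exists t : {ffun 'I_m -> 'I_n},
    [&& increasing x,
        increasing t,
        [forall j, pi (t j) == x (tnth (ap_word p) j)]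
      & [forall a in ap_arrows p, hat pi (x a.1) == x a.2]]].

Definition avoid_count (n k m : nat) (p : arrow_pattern k m) : nat :=
  #|[set pi : 'S_n | ~~ contains p pi]|.

Definition derangements (m : nat) : nat :=
  #|[set s : 'S_m | [forall i, s i != i]]|.

Lemma derangements0 : derangements 0 = 1.
Proof.
rewrite /derangements -[RHS](card_Sn 0) -cardsT; congr #|pred_of_set _|.
by apply/setP=> s; rewrite !inE; apply/forallP; case.
Qed.

Definition one : 'I_3 := @Ordinal 3 0 isT.
Definition two : 'I_3 := @Ordinal 3 1 isT.
Definition three : 'I_3 := @Ordinal 3 2 isT.

Lemma pattern_13_2to2_onto :
  [forall i : 'I_3, (i \in [tuple one; three]) ||
    [exists a in [set (two, two)], (i == a.1) || (i == a.2)]].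
Proof.
apply/forallP=> -[[|[|[|//]]] lti] //.
by apply/orP; right; apply/existsP; exists (two, two); rewrite inE eqxx.
Qed.

Definition pattern_13_2to2 : arrow_pattern 3 2 :=
  ArrowPattern pattern_13_2to2_onto.

(* Main.v *)
(* Write [theta s] as a word. A value is a fixed point of [s] iff it is a
   left-to-right maximum of the word that is either last or followed by a larger
   value; call it isolated. If the word avoids the pattern and an isolated value
   c is not the maximum N, then nothing precedes c (it would be smaller than c
   and come before N), so the word is c L K with L an arrangement of the values
   larger than c and K of the smaller ones. An isolated value of c L K other
   than c is isolated in L, and conversely except possibly for N. Such a word
   avoids the pattern iff only N may be isolated in L, while K is arbitrary.
   Words of length m + 1 in which only the maximum may be isolated number
   d_(m+1) + d_m: delete the maximum if it is isolated, in which case it is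
   last. *)
Require Import Defs.
From mathcomp Require Import all_boot fingroup perm.

Set Implicit Arguments.
Unset Strict Implicit.
Unset Printing Implicit Defensive.

(** * Words and isolated letters *)

(* [drop] starts right after [x]; the default [x.+1] of [head] makes the second
   condition hold when [x] is the last letter. *)
Definition isolated (w : seq nat) (x : nat) : bool :=
  all (ltn^~ x) (take (index x w) w) && (x < head x.+1 (drop (index x w).+1 w)).

Definition only_isolated (N : nat) (w : seq nat) : bool :=
  all (fun x => isolated w x ==> (x == N)) w.

Definition no_isolated (w : seq nat) : bool :=
  all (fun x => ~~ isolated w x) w.

(** The pattern leaves the position of its middle value free, so the pair is sought in all of [w],
    wherever [c] stands. *)
Definition avoiding (w : seq nat) : bool :=
  all (fun c => isolated w c ==>
    pairwise (fun a b => ~~ ((a < c) && (c < b))) w) w.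

Lemma isolated_cat (u v : seq nat) x : x \notin u ->
  isolated (u ++ x :: v) x = all (ltn^~ x) u && (x < head x.+1 v).
Proof.
move=> xu; rewrite /isolated index_cat (negbTE xu) /= eqxx addn0.
rewrite take_size_cat // -(cat1s x v) catA drop_size_cat //.
by rewrite size_cat addn1.
Qed.

(** * Permutations as words: fixed points, derangements and pattern avoidance *)

Definition word n (pi : 'S_n) : seq nat := [seq val (pi i) | i <- enum 'I_n].

(** Cycle heads are the left-to-right maxima of the word, and a head is followed by a larger letter
    or by nothing exactly when its cycle is a singleton. *)
Lemma isolated_theta n (s : 'S_n) (x : 'I_n) :
  isolated (word (theta s)) x = (s x == x).
Proof.
rewrite /word (map_comp val) -theta_wordE.
have sorted_cycles : pairwise (@head_lt n) (standard_cycles s).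
  rewrite -sorted_pairwise ?standard_cycles_sorted //.
  by move=> [|? ?] [|? ?] [|? ?] //=; apply: ltn_trans.
have /flattenP[c cs xc] := mem_theta_word s x.
have [m em] : exists m, c = orbit s m by case/mapP: cs => m _ ->; exists m.
move: (uniq_theta_word s) sorted_cycles (standard_cycles_wf s).
rewrite /theta_word; case/splitPr: cs => L1 L2.
rewrite flatten_cat /= pairwise_cat all_cat /= => uw.
case/and4P=> + _ c_lt _ /and3P[wf1 wfc wf2].
rewrite allrel_consr => /andP[lt_c _].
(* Earlier cycles have smaller heads, and each head bounds its own cycle. *)
have {}lt_c y : y \in flatten L1 -> y < head x c.
  case/flattenP=> -[|m1 r1] c1L y1; first by have := allP wf1 _ c1L.
  have := allP lt_c _ c1L; rewrite /head_lt; case: (c) wfc => //= m' _ _.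
  move: y1 (allP wf1 _ c1L); rewrite inE /= => /predU1P[->//|yr /allP/(_ y yr)].
  exact: ltn_trans.
have [r er] := orbit_cons s m; rewrite -em in er.
have cyc : fcycle s (m :: r) by rewrite -er em (cycle_orbit perm_inj).
have -> : (s x == x) = (r == [::]) && (x == m).
  apply/idP/andP=> [sx|[/eqP r0 /eqP->]]; last by rewrite r0 /= andbT in cyc.
  have ox : orbit s x = [:: x].
    by rewrite (@orbitE _ s [:: x]) ?mem_head //= ?eqxx ?sx.
  have xm : x = m.
    apply/eqP; rewrite eq_sym -mem_seq1 -ox.
    rewrite (in_orbit_cycle cyc) ?mem_head -?er //.
  by move: er; rewrite em -xm ox => -[<-].
move: uw wfc lt_c c_lt xc; rewrite er /= => uw /allP mr lt_c c_lt.
rewrite map_cat /= map_cat inE; case: (eqVneq x m) => /= [-> _|xm xr].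
  rewrite andbT isolated_cat; last first.
    rewrite mem_map; last exact: val_inj.
    by move: uw; rewrite cat_uniq /= negb_or => /and3P[_ /andP[]].
  rewrite (_ : all _ _ = true) /=; last first.
    by rewrite all_map; apply/allP=> y /lt_c.
  (* What follows the cycle of [m] is the next, larger head or, at the end of the word, the default
     [m.+1]. *)
  have hd : m < head m.+1 [seq val i | i <- flatten L2].
    by case: (L2) c_lt wf2 => [|[|m2 r2] L3] //= /andP[].
  case: r {uw cyc er c_lt} mr => [_|y r mr] //=.
  by apply/negbTE; rewrite -leqNgt ltnW // mr ?mem_head.
(* A letter [x] other than the head comes after [m], which is larger. *)
rewrite andbF; apply/negbTE.
case/splitPr: xr mr uw {cyc er} => r1 r2 mr uw.
rewrite map_cat /= -catA /= -cat_cons catA isolated_cat.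
  rewrite all_cat /= !negb_and -leqNgt; apply/orP; left; apply/orP; right.
  by rewrite (ltnW (mr x _)) // mem_cat mem_head orbT.
rewrite -map_cons -map_cat mem_map; last exact: val_inj.
by move: uw; rewrite -catA -cat_cons catA cat_uniq => /and3P[_ /norP[]].
Qed.

(** [word] is injective, its values are arrangements of [iota 0 n], and both lists have [n]!
    entries. *)
Lemma perm_word n :
  perm_eq [seq word s | s <- enum {: 'S_n}] (permutations (iota 0 n)).
Proof.
have inj_word : injective (@word n).
  move=> s t /eq_in_map e.
  by apply/permP=> i; apply/val_inj/e; rewrite mem_enum.
have u : uniq [seq word s | s <- enum {: 'S_n}].
  by rewrite map_inj_uniq ?enum_uniq.
apply: (uniq_perm u (permutations_uniq _)).
apply: (uniq_min_size u _ _).2 => [_ /mapP[s _ ->]|].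
  rewrite mem_permutations -(val_enum_ord n) /word map_comp perm_map //.
  apply: uniq_perm => [||i]; rewrite ?enum_uniq //.
    by rewrite (map_inj_uniq perm_inj) enum_uniq.
  by rewrite mem_enum; apply/mapP; exists ((s^-1)%g i);
    rewrite ?mem_enum ?permKV.
by rewrite size_permutations ?iota_uniq // size_iota size_map -cardE card_Sn.
Qed.

Lemma card_word n (P : pred (seq nat)) :
  #|[set s : 'S_n | P (word s)]| = count P (permutations (iota 0 n)).
Proof.
rewrite -(seq.permP (perm_word n)) count_map cardsE cardE /enum_mem size_filter.
by rewrite count_filter; apply: eq_count => s; rewrite /= andbT.
Qed.

Lemma all_word n (s : 'S_n) (P : pred nat) :
  all P (word s) = [forall i : 'I_n, P i].
Proof.
apply/allP/forallP=> [Pw i|Pi _ /mapP[i _ ->]]; last exact: Pi.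
apply: Pw; apply/mapP; exists ((s^-1)%g i); rewrite ?mem_enum //.
by rewrite permKV.
Qed.

(** [theta] is a bijection turning fixed points into isolated letters. *)
Lemma derangementsE n :
  derangements n = count no_isolated (permutations (iota 0 n)).
Proof.
rewrite -card_word -(on_card_preimset (f := @theta n)); last first.
  by apply: onW_bij; apply: injF_bij; apply: theta_inj.
apply: eq_card => s; rewrite !inE /no_isolated all_word.
by apply: eq_forallb => i; rewrite isolated_theta.
Qed.

Lemma nth_word n (s : 'S_n) (i : 'I_n) : nth 0 (word s) i = s i.
Proof. by rewrite (nth_map i) ?size_enum_ord // nth_ord_enum. Qed.

Lemma containsE n (s : 'S_n) :
  ~~ contains pattern_13_2to2 s = avoiding (word s).
Proof.
have sz : size (word s) = n by rewrite size_map size_enum_ord.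
have iso (i : 'I_n) : isolated (word s) i = (hat s i == i).
  by rewrite -isolated_theta theta_hat.
rewrite /avoiding all_word; apply/idP/forallP => [+ c|av].
  rewrite iso; apply: contraR; rewrite negb_imply => /andP[hc pw].
  have /existsP[i /existsP[j /and3P[lt_ij sic scj]]] :
      [exists i : 'I_n, exists j : 'I_n, [&& i < j, s i < c & c < s j]].
    apply: contraNT pw => no; apply/(pairwiseP 0) => i j.
    rewrite !inE sz => ltin ltjn lt_ij; apply: contraNN no => ac.
    apply/existsP; exists (Ordinal ltin); apply/existsP; exists (Ordinal ltjn).
    by rewrite -!nth_word /= lt_ij.
  apply/existsP.
  (* Labels 1, 2, 3 receive the values [s i < c < s j]; the word 13 occupies the positions
     [i < j]. *)
  exists [ffun k : 'I_3 =>
    if k == Defs.one then s i else if k == two then c else s j].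
  apply/existsP; exists [ffun k : 'I_2 => if k == ord0 then i else j].
  apply/and4P; split.
  - apply/forallP=> -[[|[|[|//]]] ltk]; apply/forallP=> -[[|[|[|//]]] ltk'];
    rewrite !ffunE //=; exact: ltn_trans scj.
  - by apply/forallP=> -[[|[|//]] ltk]; apply/forallP=> -[[|[|//]] ltk'];
    rewrite !ffunE.
  - by apply/forallP=> -[[|[|//]] ltk]; rewrite !ffunE.
  - by apply/forallP=> a; apply/implyP;
    rewrite inE => /eqP-> /=; rewrite !ffunE.
apply/existsP=> -[x /existsP[t /and4P[/forallP incx /forallP inct wt arr]]].
(* The arrow makes [x two] a fixed point of [hat s], hence an isolated letter. *)
have /implyP := forallP arr (two, two); rewrite inE eqxx => /(_ isT) /= hc.
have := av (x two); rewrite iso hc /= => /(pairwiseP 0) pw.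
have := pw (t ord0) (t ord_max); rewrite !inE sz !ltn_ord !nth_word.
move=> /(_ isT isT (implyP (forallP (inct ord0) ord_max) isT)).
rewrite (eqP (forallP wt ord0)) (eqP (forallP wt ord_max)) => /negP[].
by rewrite (implyP (forallP (incx Defs.one) two)) //;
  apply: (implyP (forallP (incx two) three)).
Qed.

(** * Words in which only the maximum may be isolated *)

Lemma isolated_shift c (w : seq nat) x : uniq w -> x \in w ->
  isolated [seq c + y | y <- w] (c + x) = isolated w x.
Proof.
move=> + xw; case/splitPr: xw => u v.
rewrite cat_uniq /= negb_or => /and3P[_ /andP[xu _] _].
rewrite map_cat /= !isolated_cat ?(mem_map (@addnI c)) // all_map.
congr (_ && _); first by apply: eq_all => y /=; rewrite ltn_add2l.
by case: v => [|y v] /=; rewrite ?ltn_add2l ?ltnSn.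
Qed.

Lemma perm_permutations_shift c k :
  perm_eq [seq [seq c + y | y <- w] | w <- permutations (iota 0 k)]
          (permutations (iota c k)).
Proof.
have u : uniq [seq [seq c + y | y <- w] | w <- permutations (iota 0 k)].
  by rewrite map_inj_uniq ?permutations_uniq //; apply/inj_map/addnI.
apply: (uniq_perm u (permutations_uniq _)).
apply: (uniq_min_size u _ _).2 => [_ /mapP[w + ->]|].
  rewrite !mem_permutations => /(perm_map (addn c)).
  by rewrite -iotaDl addn0.
by rewrite size_map !size_permutations ?iota_uniq // !size_iota.
Qed.

(** Isolation depends only on the relative order of the letters; this brings blocks of large letters
    back to initial ranges. *)
Lemma count_only_isolated_shift c m k :
  count (only_isolated (c + m)) (permutations (iota c k)) =
  count (only_isolated m) (permutations (iota 0 k)).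
Proof.
rewrite -(seq.permP (perm_permutations_shift c k)) count_map.
apply: eq_in_count => w; rewrite mem_permutations => /perm_uniq.
rewrite iota_uniq /only_isolated /= all_map => uw.
by apply: eq_in_all => x xw /=; rewrite isolated_shift // eqn_add2l.
Qed.

(** If [x] ends [w], the appended [m] replaces the default [x.+1] as a larger successor. *)
Lemma isolated_rcons (w : seq nat) m x : uniq w -> x \in w -> x < m ->
  isolated (rcons w m) x = isolated w x.
Proof.
move=> + xw; case/splitPr: xw => u v.
rewrite cat_uniq /= negb_or => /and3P[_ /andP[xu _] _] ltxm.
rewrite rcons_cat /= !isolated_cat //.
by case: v => [|y v] //=; rewrite ltxm ltnSn.
Qed.

Lemma isolated_last (w : seq nat) m : m \notin w -> all (ltn^~ m) w ->
  isolated (rcons w m) m.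
Proof. by move=> mw lt_m; rewrite -cats1 isolated_cat //= lt_m ltnSn. Qed.

Lemma iota_rcons m : iota 0 m.+1 = rcons (iota 0 m) m.
Proof. by rewrite -addn1 iotaD cats1. Qed.

Lemma count_sub (T : eqType) (a b : pred T) (s : seq T) :
    {in s, forall x, a x -> b x} ->
  count b s = count a s + count (predI b (predC a)) s.
Proof.
move=> sub; rewrite -(size_filter b) -(count_predC a) !count_filter.
congr (_ + _); last by apply: eq_count => x /=; rewrite andbC.
by apply: eq_in_count => x xs /=; case ax: (a x); rewrite //= sub.
Qed.

(** An isolated maximum cannot be followed by a larger letter, so it comes last, and deleting it
    leaves the isolation of the other letters unchanged. *)
Lemma perm_only_isolated m :
  perm_eq
    [seq w <- permutations (iota 0 m.+1)
       | only_isolated m w && ~~ no_isolated w]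
    [seq rcons w m | w <- permutations (iota 0 m) & no_isolated w].
Proof.
apply: uniq_perm => [||w].
- by rewrite filter_uniq ?permutations_uniq.
- by rewrite map_inj_uniq ?filter_uniq ?permutations_uniq //; apply: rcons_injl.
have permP u : perm_eq (rcons u m) (iota 0 m.+1) = perm_eq u (iota 0 m).
  by rewrite iota_rcons -!cats1 perm_cat2r.
have factsP u : perm_eq u (iota 0 m) ->
    [/\ uniq u, m \notin u & forall x, x \in u -> x < m].
  move=> pu; rewrite (perm_uniq pu) iota_uniq (perm_mem pu) mem_iota ltnn.
  by split=> // x; rewrite (perm_mem pu) mem_iota.
rewrite mem_filter mem_permutations; apply/idP/mapP=> [|[u]].
  case/andP=> /andP[only no] pw.
  case/allPn: no => x xw /negPn ix.
  have /eqP e := implyP (allP only _ xw) ix; subst x.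
  case/splitPr: xw pw only ix => u v pw only.
  have : uniq (u ++ m :: v) by rewrite (perm_uniq pw) iota_uniq.
  rewrite cat_uniq /= negb_or -!andbA => /and5P[uu mu _ _ _].
  rewrite isolated_cat // => /andP[_].
  case: v pw only => [|y v] pw only /= lt_my.
    rewrite cats1 in pw only *; exists u => //.
    rewrite permP in pw; rewrite mem_filter mem_permutations pw andbT.
    have [_ _ lt_m] := factsP _ pw.
    apply/allP=> x xu; have := allP only x; rewrite mem_rcons inE xu orbT.
    rewrite isolated_rcons ?lt_m // => /(_ isT).
    by case: eqP => [e|]; [rewrite e (negbTE mu) in xu | rewrite implybF].
  (* A letter [y] right after the isolated [m] would exceed the maximum. *)
  have := perm_mem pw y.
  by rewrite mem_iota mem_cat !inE eqxx !orbT ltnS (leqNgt y) lt_my andbF.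
rewrite mem_filter mem_permutations => /andP[no pu] ->.
have [uu mu lt_m] := factsP _ pu; rewrite permP pu andbT; apply/andP; split.
  apply/allP=> x; rewrite mem_rcons inE => /predU1P[->|xu].
    by rewrite eqxx implybT.
  by rewrite isolated_rcons // ?lt_m // (negbTE (allP no _ xu)).
apply/allPn; exists m; rewrite ?mem_rcons ?mem_head // negbK.
by rewrite isolated_last //; apply/allP.
Qed.

(** Either no letter is isolated, or exactly the maximum is and can be deleted. *)
Lemma count_only_isolated m :
  count (only_isolated m) (permutations (iota 0 m.+1)) =
  derangements m.+1 + derangements m.
Proof.
rewrite !derangementsE (count_sub (a := no_isolated)); last first.
  move=> w _ no; by apply/allP=> x xw; rewrite (negbTE (allP no _ xw)).
congr (_ + _); have := perm_size (perm_only_isolated m).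
by rewrite size_map !size_filter => <-.
Qed.

(** * Words made of a letter, then larger letters, then smaller ones *)

(** Once a letter below [c] has occurred, no letter above [c] may follow. *)
Lemma pairwise_split c (v : seq nat) : c \notin v ->
  pairwise (fun a b => ~~ (a < c < b)) v ->
  v = [seq y <- v | c < y] ++ [seq y <- v | y < c].
Proof.
elim: v => //= y v IH; rewrite inE negb_or => /andP[cy cv] /andP[yv pv].
case: ltngtP cy => // [ltcy|ltyc] _; first by rewrite /= -IH.
have cl : [seq z <- v | c < z] = [::].
  apply/eqP; rewrite -[_ == _]negbK -has_filter -all_predC.
  by apply: sub_all yv => z /=; rewrite ltyc.
by rewrite {1}(IH cv pv) cl.
Qed.

Lemma in_pairwise (T : eqType) (r : rel T) (s : seq T) :
  {in s &, forall x y, r x y} -> pairwise r s.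
Proof.
elim: s => //= x s IH rs; apply/andP; split.
  by apply/allP=> y ys; apply: rs; rewrite ?mem_head // inE ys orbT.
by apply: IH => y z ys zs; apply: rs; rewrite inE ?ys ?zs orbT.
Qed.

Section BlockWord.

Variables (N c : nat) (L S : seq nat).
Let w := c :: L ++ S.
Hypotheses (uw : uniq w) (gtL : forall x, x \in L -> c < x <= N)
  (ltS : forall x, x \in S -> x < c) (NL : N \in L).

Let isolated_head : isolated w c.
Proof.
rewrite -[w]cat0s isolated_cat //=.
by case: L NL gtL => //= y l _ /(_ y (mem_head _ _)) /andP[].
Qed.

(** The larger letter [c] precedes [x]. *)
Let isolated_small x : x \in S -> ~~ isolated w x.
Proof.
move=> xS; move: (uw) (ltS xS); rewrite /w.
case/splitPr: xS => u v; rewrite catA -cat_cons => + ltxc.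
rewrite cat_uniq [has _ _]/= => /and3P[_ /norP[xu _] _].
by rewrite isolated_cat //= ltnNge ltnW.
Qed.

(** From [w] to [L], the part before [x] only loses [c], and [x] keeps its successor or becomes
    last. *)
Let isolated_large x : x \in L -> isolated w x -> isolated L x.
Proof.
move=> xL; move: (uw) ltS (gtL xL); rewrite /w; case/splitPr: xL => u v.
rewrite -catA -cat_cons cat_uniq [has _ _]/= => /and3P[_ /norP[xu _] _].
move: (xu); rewrite inE negb_or => /andP[_ xu'] _ _.
rewrite !isolated_cat // => /andP[/= /andP[_ ->]].
by case: v => /=; rewrite ?ltnSn.
Qed.

(** Only the last letter of [L] gets a new successor in [w]; an isolated letter in that place would
    exceed all others in [L], hence be [N]. *)
Let large_isolated x : x \in L -> x != N -> isolated L x -> isolated w x.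
Proof.
move=> xL; move: (uw) NL (gtL xL); rewrite /w; case/splitPr: xL => u v.
rewrite -catA -cat_cons cat_uniq [has _ _]/= => /and3P[_ /norP[xu _] _].
move: (xu); rewrite inE negb_or => /andP[_ xu'].
rewrite mem_cat inE => + /andP[ltcx lexN] neqxN.
rewrite (eq_sym N) (negbTE neqxN) isolated_cat // isolated_cat //.
move=> Nuv /andP[ltu].
rewrite /= ltcx ltu; case: v Nuv => //=.
rewrite orbF => /(allP ltu) /=.
by rewrite ltnNge lexN.
Qed.

Lemma only_isolated_block : only_isolated N w = false.
Proof.
apply/negP=> /allP/(_ c (mem_head _ _)); rewrite isolated_head /= => /eqP e.
by have := gtL NL; rewrite e ltnn.
Qed.

(** An isolated letter of [L] other than [N] stays isolated in [w] and lies between [c] and the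
    later [N], which is an occurrence. Otherwise only [c] and possibly [N] are isolated: letters
    above [c] precede those below it, and nothing exceeds [N]. *)
Lemma avoiding_block : avoiding w = only_isolated N L.
Proof.
apply/allP/allP=> [av x xL|only x xw].
  apply/implyP=> ix; apply: contraT => neqxN.
  have xw : x \in w by rewrite inE mem_cat xL orbT.
  have := av x xw; rewrite (large_isolated xL neqxN ix) /=.
  move=> /andP[/allP/(_ N)].
  have /andP[-> lexN] := gtL xL.
  by rewrite mem_cat NL ltn_neqAle neqxN lexN => /(_ isT).
apply/implyP=> ix; move: (xw); rewrite inE mem_cat.
case/or3P=> [/eqP->|xL|xS]; last by rewrite (negbTE (isolated_small xS)) in ix.
  rewrite /w pairwise_cons; apply/andP; split.
    by apply/allP=> y _; rewrite ltnn.
  rewrite pairwise_cat; apply/and3P; split.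
  - apply/allrelP=> a b aL _; have /andP[ca _] := gtL aL.
    by rewrite ltnNge (ltnW ca).
  - by apply: in_pairwise => a b /gtL/andP[ca _] _; rewrite ltnNge (ltnW ca).
  - apply: in_pairwise => a b _ /ltS bc.
    by rewrite negb_and -(leqNgt b) (ltnW bc) orbT.
have /eqP -> := implyP (only x xL) (isolated_large xL ix).
apply: in_pairwise => a b _ bw; rewrite negb_and -(leqNgt b); apply/orP; right.
have /andP[ltcN _] := gtL NL.
move: bw; rewrite inE mem_cat => /or3P[/eqP->|/gtL/andP[]//|/ltS bc].
  exact: ltnW.
exact: ltnW (ltn_trans bc ltcN).
Qed.

End BlockWord.

(** * Counting avoiding words by first letter *)

(** Letters before an isolated [c] are smaller, so [N], if different from [c], comes after it; a
    letter before [c] would then form with [N] a forbidden pair around [c]. *)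
Lemma avoiding_head N (w : seq nat) : perm_eq w (iota 0 N.+1) ->
    avoiding w -> ~~ only_isolated N w ->
  exists c v, [/\ c < N, w = c :: v &
    pairwise (fun a b => ~~ (a < c < b)) v].
Proof.
move=> pw av /allPn[c cw]; rewrite negb_imply => /andP[ic neqcN].
have ltcN : c < N.
  by move: cw; rewrite (perm_mem pw) mem_iota add0n ltnS ltn_neqAle neqcN.
have Nw : N \in w by rewrite (perm_mem pw) mem_iota /= add0n.
have := av; move/allP/(_ c cw); rewrite ic /=.
have uw : uniq w by rewrite (perm_uniq pw) iota_uniq.
case/splitPr: cw uw ic Nw {pw av} => u v uw.
move: (uw); rewrite cat_uniq [has _ _]/= => /and3P[_ /norP[cu _] _].
rewrite isolated_cat // => /andP[ltu _] Nuv.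
case: u uw cu ltu Nuv => [|y u] _ _ /=.
  by move=> _ _ /andP[_ pv]; exists c, v.
case/andP=> ltyc ltu Nuv /andP[/allP/(_ N)].
rewrite ltyc ltcN => /(_ _)/negP[] //.
move: Nuv; rewrite inE => /predU1P[e|//].
by rewrite -e ltnNge ltnW in ltyc.
Qed.

(** The map sending [L] and [K] to [c :: L ++ K] is inverted by filtering the tail into letters
    above and below [c]. *)
Lemma perm_avoiding_block N c : c < N ->
  perm_eq
    [seq w <- permutations (iota 0 N.+1) |
       [&& avoiding w, ~~ only_isolated N w & head N w == c]]
    [seq c :: L ++ K | L <- [seq L <- permutations (iota c.+1 (N - c))
                                 | only_isolated N L],
                       K <- permutations (iota 0 c)].
Proof.
move=> ltcN; apply: uniq_perm => [||w].
- by rewrite filter_uniq ?permutations_uniq.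
- apply: allpairs_uniq; rewrite ?filter_uniq ?permutations_uniq //.
  (* All [L] have the same length [N - c], so the concatenation determines both factors. *)
  move=> [L K] [L' K'] /allpairsP[[L1 K1] [/= L1P _ [-> ->]]].
  case/allpairsP=> [[L2 K2] [/= L2P _ [-> ->]]] /= [] /eqP.
  move: L1P L2P; rewrite !mem_filter !mem_permutations.
  move=> /andP[_ /perm_size s1] /andP[_ /perm_size s2].
  by rewrite eqseq_cat ?s1 ?s2 // => /andP[/eqP-> /eqP->].
rewrite mem_filter mem_permutations.
have iotaE : perm_eq (iota 0 N.+1) (c :: iota c.+1 (N - c) ++ iota 0 c).
  have -> : N.+1 = c + (N - c).+1 by rewrite addnS subnKC // ltnW.
  by rewrite iotaD perm_catC.
apply/idP/allpairsP=> [/andP[/and3P[av no hd] pw]|[[L K] [/=]]].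
  have [x [v [ltxN e pv]]] := avoiding_head pw av no.
  move: hd; rewrite {1}e /= => /eqP ex; subst x w.
  have /andP[cv uv] : uniq (c :: v) by rewrite (perm_uniq pw) iota_uniq.
  have memv y : (y \in v) = (y != c) && (y <= N).
    have := perm_mem pw y; rewrite inE mem_iota add0n ltnS /= => <-.
    by case: eqVneq => [->|]; first exact: negbTE.
  have ev := pairwise_split cv pv.
  have pL : perm_eq [seq y <- v | c < y] (iota c.+1 (N - c)).
    apply: uniq_perm; rewrite ?filter_uniq ?iota_uniq // => y.
    rewrite mem_filter memv mem_iota addSn subnKC ?ltnS; last exact: ltnW.
    by case: ltngtP.
  have pK : perm_eq [seq y <- v | y < c] (iota 0 c).
    apply: uniq_perm; rewrite ?filter_uniq ?iota_uniq // => y.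
    rewrite mem_filter memv mem_iota /=.
    by case: ltngtP => //= ltyc; rewrite ltnW // (ltn_trans ltyc).
  exists ([seq y <- v | c < y], [seq y <- v | y < c]).
  rewrite /= -ev mem_filter !mem_permutations pL pK andbT; split=> //.
  rewrite -(@avoiding_block N c _ [seq y <- v | y < c]) -?ev /= ?cv //.
  - by move=> y; rewrite mem_filter memv => /and3P[-> _].
  - by move=> y; rewrite mem_filter => /andP[].
  - by rewrite mem_filter memv leqnn andbT ltcN gtn_eqF.
rewrite mem_filter !mem_permutations => /andP[only pL] pS ->.
have pw : perm_eq (c :: L ++ K) (iota 0 N.+1).
  by rewrite perm_sym (perm_trans iotaE) // perm_cons perm_sym perm_cat.
have uw : uniq (c :: L ++ K) by rewrite (perm_uniq pw) iota_uniq.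
have gtL x : x \in L -> c < x <= N.
  rewrite (perm_mem pL) mem_iota addSn subnKC ?ltnS //; exact: ltnW.
have ltS x : x \in K -> x < c by rewrite (perm_mem pS) mem_iota.
have NL : N \in L.
  by rewrite (perm_mem pL) mem_iota ltcN addSn subnKC ?ltnSn // ltnW.
rewrite (avoiding_block uw gtL ltS NL) only (only_isolated_block _ gtL NL).
by rewrite /= eqxx.
Qed.

(** [L] arranges [N - c] letters with only the maximum possibly isolated, while [K] is any
    arrangement of the [c] small letters. *)
Lemma count_avoiding_block N c : c < N ->
  count (fun w => [&& avoiding w, ~~ only_isolated N w & head N w == c])
    (permutations (iota 0 N.+1)) =
  (derangements (N - c) + derangements (N - c).-1) * c`!.
Proof.
move=> ltcN; have := perm_size (perm_avoiding_block ltcN).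
rewrite size_allpairs size_permutations ?iota_uniq // size_iota.
rewrite !size_filter => ->.
(* Shifting down by [c.+1] turns the maximum [N] of [L] into [m], with [m.+1 = N - c] letters. *)
have [m ->] : exists m, N = c.+1 + m by exists (N - c.+1); rewrite subnKC.
by rewrite addSnnS addKn -addSnnS count_only_isolated_shift count_only_isolated.
Qed.

Lemma count_partition (T : eqType) (f : T -> nat) (a : pred T) N (s : seq T) :
    {in s, forall x, a x -> f x < N} ->
  count a s = \sum_(c < N) count (fun x => a x && (f x == c)) s.
Proof.
move=> af; rewrite -sum1_count big_mkcond /=.
under [RHS]eq_bigr do rewrite -sum1_count big_mkcond /=.
rewrite exchange_big; apply: eq_big_seq => x xs /=.
case ax: (a x) => /=; last by rewrite big1.
rewrite (bigD1 (Ordinal (af x xs ax))) //= eqxx big1 // => i.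
by rewrite -val_eqE /= eq_sym => /negbTE->.
Qed.

(** The only candidate for the middle value is [N], and no letter exceeds it. *)
Lemma only_isolated_avoiding N (w : seq nat) :
  perm_eq w (iota 0 N.+1) -> only_isolated N w -> avoiding w.
Proof.
move=> pw /allP only; apply/allP=> x xw; apply/implyP=> ix.
have /eqP-> := implyP (only x xw) ix.
apply: in_pairwise => a b _; rewrite (perm_mem pw) mem_iota add0n ltnS /=.
by move=> leb; rewrite negb_and -(leqNgt b) leb orbT.
Qed.

Theorem theorem5p6 (n : nat) (hn : 3 <= n) :
  avoid_count n pattern_13_2to2 =
    derangements n + derangements (n - 1) +
    \sum_(1 <= k < n)
       (derangements (n - k) + derangements (n - k - 1)) * (k - 1)`!.
Proof.
case: n hn => // N _.
have -> : avoid_count N.+1 pattern_13_2to2 =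
    count avoiding (permutations (iota 0 N.+1)).
  rewrite -card_word; apply: eq_card => s.
  by rewrite !inE containsE.
(* Words where at most [N] is isolated give the first two terms; the others are sorted by first
   letter. *)
rewrite (count_sub (a := only_isolated N)); last first.
  by move=> w; rewrite mem_permutations; apply: only_isolated_avoiding.
rewrite count_only_isolated subn1; congr (_ + _).
rewrite (count_partition (f := head N) (N := N)); last first.
  move=> w; rewrite mem_permutations => pw /andP[no av].
  by have [c [v [ltcN -> _]]] := avoiding_head pw no av.
(* Letters start at 0, so the first letter [c] corresponds to the index [k = c.+1]. *)
rewrite big_add1 big_mkord; apply: eq_bigr => c _.
rewrite subSS !subn1 -count_avoiding_block //.
by apply: eq_count => w /=; rewrite andbA.
Qed.
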